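(* Let $\Gamma$ be an inverse semigroup. The set $\mathcal{O}(\Gamma)$ of equivalence classes of directed subsets of $\Gamma$, with multiplication $[A][B]=[AB]$ and inversion $[A]^{-1}=[A^{-1}]$, is an inverse semigroup. Moreover, for $X,Y\in\mathcal{O}(\Gamma)$, the relation $X\prec Y$ (the natural order of the inverse semigroup $\mathcal{O}(\Gamma)$, i.e. $XY^{-1}=XX^{-1}$) holds if and only if $A\prec B$ for some (equivalently, all) representatives $A$ of $X$ and $B$ of $Y$.
   Context: For an inverse semigroup $S$ and $x,y\in S$, $x\prec y$ means $xy^{-1}=xx^{-1}$; this is the natural partial order. A subset $A$ of $\Gamma$ is called (downward) directed if it is nonempty and for any $x,y\in A$ there exists $z\in A$ with $z\prec x$ and $z\prec y$. Let $\mathcal{F}(\Gamma)$ be the set of directed subsets of $\Gamma$. For $A,B\in\mathcal{F}(\Gamma)$ write $A\prec B$ if for every $b\in B$ there is $a\in A$ with $a\prec b$; write $A\sim B$ if $A\prec B$ and $B\prec A$ (an equivalence relation). Put $AB=\{ab: a\in A,b\in B\}$ and $A^{-1}=\{a^{-1}:a\in A\}$; these are again directed. $\mathcal{O}(\Gamma)=\mathcal{F}(\Gamma)/\!\sim$, and $[A]$ denotes the class of $A$. The operations $[A][B]=[AB]$ and $[A]\mapsto[A^{-1}]$ are well defined on classes. *)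

(* Defs.v *)
From HB Require Import structures.
From mathcomp Require Import all_boot.
From mathcomp Require Import boolp classical_sets.

Set Implicit Arguments.
Unset Strict Implicit.
Unset Printing Implicit Defensive.

Local Open Scope classical_set_scope.
Local Open Scope quotient_scope.

Declare Scope invsg_scope.
Delimit Scope invsg_scope with S.
Local Open Scope invsg_scope.

(* MathComp attaches ^-1 to magmas with a unit; an inverse semigroup need not
   have one, so inversion is reintroduced here over unit-free magmas.        *)
HB.mixin Record hasSinv S := { sinv : S -> S }.

#[short(type="invMagmaType")]
HB.structure Definition InvMagma := {S of hasSinv S & Magma S}.

Notation "x * y" := (mul x%S y%S) : invsg_scope.
Notation "x ^-1" := (sinv x%S) : invsg_scope.

Definition is_inverse_of (S : invMagmaType) (x y : S) : Prop :=
  x * y * x = x /\ y * x * y = y.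

Definition inverse_semigroup (S : invMagmaType) : Prop :=
  associative (@mul S) /\ forall x : S, unique (is_inverse_of x) x^-1.

HB.mixin Record InvMagma_isInverseSemigroup S of InvMagma S := {
  inverse_semigroupP : inverse_semigroup S
}.

(* No choice or nonemptiness assumption is put on the carrier. *)
#[short(type="inverseSemigroupType")]
HB.structure Definition InverseSemigroup :=
  {S of InvMagma_isInverseSemigroup S & InvMagma S}.

Definition natural_le (S : invMagmaType) (x y : S) : Prop :=
  x * y^-1 = x * x^-1.

Section InverseSemigroupTheory.
Variable S : inverseSemigroupType.
Implicit Types x y z e f : S.

Lemma smulA : associative (@mul S).
Proof. by case: (@inverse_semigroupP S). Qed.

Lemma smulVK x : x * x^-1 * x = x.
Proof. by case: (@inverse_semigroupP S) => _ /(_ x) [[]]. Qed.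

Lemma sinvMK x : x^-1 * x * x^-1 = x^-1.
Proof. by case: (@inverse_semigroupP S) => _ /(_ x) [[]]. Qed.

Lemma sinv_uniq x y : x * y * x = x -> y * x * y = y -> x^-1 = y.
Proof. by case: (@inverse_semigroupP S) => _ /(_ x) [_ u] *; apply: u. Qed.

Lemma sinvK x : x^-1^-1 = x.
Proof. by apply: sinv_uniq; [exact: sinvMK | exact: smulVK]. Qed.

Lemma sinv_idem e : e * e = e -> e^-1 = e.
Proof. by move=> ee; apply: sinv_uniq; rewrite !ee. Qed.

Lemma idem_mulV x : (x * x^-1) * (x * x^-1) = x * x^-1.
Proof. by rewrite smulA smulVK. Qed.

Lemma idem_Vmul x : (x^-1 * x) * (x^-1 * x) = x^-1 * x.
Proof. by rewrite smulA sinvMK. Qed.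

Lemma idem_mul e f : e * e = e -> f * f = f -> (e * f) * (e * f) = e * f.
Proof.
move=> ee ff; set x := (e * f)^-1.
have efxef : e * f * x * (e * f) = e * f := smulVK _.
have xefx : x * (e * f) * x = x := sinvMK _.
have xE : x = f * x * e.
  apply: sinv_uniq.
    rewrite !smulA -(smulA e f f) ff -(smulA _ e e) ee.
    by rewrite -(smulA _ e f) efxef.
  rewrite !smulA -(smulA _ e e) ee -(smulA _ f f) ff.
  by rewrite -(smulA _ x e) -!smulA; congr (f * _); rewrite !smulA
     -(smulA x) xefx.
have xx : x * x = x.
  rewrite {1 2}xE !smulA -(smulA _ e f) -(smulA f x) -(smulA f) xefx.
  by rewrite -xE.
by have := sinv_idem xx; rewrite /x sinvK => ->.
Qed.

Lemma idemC e f : e * e = e -> f * f = f -> e * f = f * e.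
Proof.
move=> ee ff; have efef := idem_mul ee ff; have fefe := idem_mul ff ee.
rewrite -(sinv_idem efef); apply: sinv_uniq.
  by rewrite !smulA -(smulA e f f) ff -(smulA _ e e) ee -(smulA (e * f)) efef.
by rewrite !smulA -(smulA f e e) ee -(smulA _ f f) ff -(smulA (f * e)) fefe.
Qed.

Lemma sinvM x y : (x * y)^-1 = y^-1 * x^-1.
Proof.
apply: sinv_uniq.
  rewrite !smulA -(smulA x) -(smulA _ x^-1) -(smulA x).
  by rewrite (idemC (idem_mulV y) (idem_Vmul x)) !smulA smulVK -!smulA smulA
     -(smulA x y) (smulA y) smulVK.
rewrite !smulA -(smulA y^-1) -(smulA _ y) -(smulA y^-1).
by rewrite (idemC (idem_Vmul x) (idem_mulV y)) !smulA sinvMK -smulA -smulA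
   (smulA x^-1) sinvMK.
Qed.

Lemma natural_leP x y :
  natural_le x y <-> exists2 f, f * f = f & x = y * f.
Proof.
split=> [xy | [f ff ->]].
  exists (x^-1 * x); first exact: idem_Vmul.
  have /(congr1 (@sinv S)) := xy; rewrite !sinvM !sinvK => yx.
  by rewrite smulA yx smulVK.
by rewrite /natural_le sinvM (sinv_idem ff) !smulA -(smulA y f f) ff.
Qed.

Lemma natural_leP' x y :
  natural_le x y <-> exists2 e, e * e = e & x = e * y.
Proof.
split=> [/natural_leP[f ff ->] | [e ee ->]].
  exists (y * f * y^-1).
    rewrite !smulA -(smulA _ y^-1 y) -(smulA y f) (idemC ff (idem_Vmul y)).
    by rewrite !smulA smulVK -(smulA y f f) ff.
  rewrite -(smulA _ y^-1 y) -(smulA y f) (idemC ff (idem_Vmul y)).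
  by rewrite !smulA smulVK.
apply/natural_leP; exists (y^-1 * e * y).
  rewrite !smulA -(smulA _ y y^-1) -(smulA y^-1 e) (idemC ee (idem_mulV y)).
  by rewrite !smulA sinvMK -(smulA y^-1 e e) ee.
rewrite !smulA (idemC (idem_mulV y) ee) -!smulA (smulA y) smulVK //.
Qed.

Lemma natural_le_refl x : natural_le x x.
Proof. by []. Qed.

Lemma natural_le_trans y x z :
  natural_le x y -> natural_le y z -> natural_le x z.
Proof.
move=> /natural_leP[f ff ->] /natural_leP[g gg ->]; apply/natural_leP.
by exists (g * f); [exact: idem_mul | rewrite smulA].
Qed.

Lemma natural_leM x x' y y' : natural_le x x' -> natural_le y y' ->
  natural_le (x * y) (x' * y').
Proof.
move=> /natural_leP[f ff ->] /natural_leP'[e ee ->].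
have /natural_leP[h hh hE] : natural_le (f * e * y') y'.
  by apply/natural_leP'; exists (f * e) => //; exact: idem_mul.
by apply/natural_leP; exists h => //; rewrite -(smulA x' y') -hE !smulA.
Qed.

Lemma natural_leV x y : natural_le x y -> natural_le x^-1 y^-1.
Proof.
move=> /natural_leP[f ff ->]; apply/natural_leP'.
by exists f => //; rewrite sinvM (sinv_idem ff).
Qed.

End InverseSemigroupTheory.

Section DirectedSubsets.
Variable G : inverseSemigroupType.
Implicit Types A B : set G.

Definition directed A : Prop :=
  A !=set0 /\ forall x y, A x -> A y ->
    exists z, [/\ A z, natural_le z x & natural_le z y].

Definition set_prec A B : Prop :=
  forall b, B b -> exists2 a, A a & natural_le a b.

Definition set_sim A B : Prop := set_prec A B /\ set_prec B A.

Definition set_mul A B : set G := [set a * b | a in A & b in B].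
Definition set_inv A : set G := [set a^-1 | a in A].

Lemma set_prec_refl A : set_prec A A.
Proof. by move=> a Aa; exists a. Qed.

Lemma set_prec_trans B A C : set_prec A B -> set_prec B C -> set_prec A C.
Proof.
move=> AB BC c /BC[b /AB[a Aa ab] bc]; exists a => //.
exact: natural_le_trans bc.
Qed.

Lemma directed_mul A B : directed A -> directed B -> directed (set_mul A B).
Proof.
move=> [[a Aa] dA] [[b Bb] dB]; split; first by exists (a * b), a => //; exists b.
move=> _ _ [x Ax [y By <-]] [x' Ax' [y' By' <-]].
have [z [Az zx zx']] := dA _ _ Ax Ax'; have [t [Bt ty ty']] := dB _ _ By By'.
exists (z * t); split; [by exists z => //; exists t | exact: natural_leM..].
Qed.

Lemma directed_inv A : directed A -> directed (set_inv A).
Proof.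
move=> [[a Aa] dA]; split; first by exists a^-1, a.
move=> _ _ [x Ax <-] [y Ay <-]; have [z [Az zx zy]] := dA _ _ Ax Ay.
by exists z^-1; split; [exists z | exact: natural_leV..].
Qed.

End DirectedSubsets.

Record directed_set (G : inverseSemigroupType) := DirectedSet {
  dset :> set G;
  directedP : directed dset
}.

HB.instance Definition _ (G : inverseSemigroupType) :=
  gen_eqMixin (directed_set G).
HB.instance Definition _ (G : inverseSemigroupType) :=
  gen_choiceMixin (directed_set G).

Section Quotient.
Variable G : inverseSemigroupType.
Implicit Types A B : directed_set G.

Definition dmul A B : directed_set G :=
  DirectedSet (directed_mul (directedP A) (directedP B)).

Definition dinv A : directed_set G := DirectedSet (directed_inv (directedP A)).

Definition dsim : rel (directed_set G) := fun A B => `[< set_sim A B >].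

Lemma dsim_refl : reflexive dsim.
Proof. by move=> A; apply/asboolP; split; exact: set_prec_refl. Qed.

Lemma dsim_sym : symmetric dsim.
Proof. by move=> A B; apply/asboolP/asboolP => -[]. Qed.

Lemma dsim_trans : transitive dsim.
Proof.
move=> B A C /asboolP[AB BA] /asboolP[BC CB]; apply/asboolP.
by split; apply: set_prec_trans; eassumption.
Qed.

Canonical dsim_equiv := EquivRel dsim dsim_refl dsim_sym dsim_trans.

Definition directed_class : Type := {eq_quot dsim_equiv}.

HB.instance Definition _ := EqQuotient.on directed_class.
HB.instance Definition _ := Choice.on directed_class.

Definition dclass A : directed_class := \pi_directed_class A.

(* The operations are computed on chosen representatives; that they satisfy
   [A][B] = [AB] and [A]^-1 = [A^-1] is not built into the definition.      *)
HB.instance Definition _ := hasMul.Build directed_class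
  (fun X Y => dclass (dmul (repr X) (repr Y))).
HB.instance Definition _ := hasSinv.Build directed_class
  (fun X => dclass (dinv (repr X))).

End Quotient.

Notation "''O' ( G )" := (directed_class G) (format "''O' ( G )") : type_scope.

(* Main.v *)
(* The only delicate point is uniqueness of inverses, which reduces to the
   commutation of idempotent classes. If EE ~ E, then for each c in E some d in E
   satisfies d <= c and d <= cc, and these two inequalities force dd = d. Hence
   the idempotents of E are cofinal downwards in E, and idempotent classes
   commute because idempotents of the semigroup do. *)
Require Import Defs.
From mathcomp Require Import all_boot.
From mathcomp Require Import boolp classical_sets.

Set Implicit Arguments.
Unset Strict Implicit.
Unset Printing Implicit Defensive.

Local Open Scope classical_set_scope.
Local Open Scope invsg_scope.

(** For two inverses y and z of x, commuting [x * z] with [x * y] turns y into [y * x * z], and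
    commuting [z * x] with [y * x] turns z into the same product. *)
Lemma inverse_semigroup_idemC (S : invMagmaType) :
    associative (@mul S) ->
    (forall x : S, is_inverse_of x x^-1) ->
    (forall e f : S, e * e = e -> f * f = f -> e * f = f * e) ->
  inverse_semigroup S.
Proof.
move=> A inv C; split=> // x; split=> // z [xzx zxz].
have [] := inv x; move: (x^-1) => y xyx yxy.
have idl (u v : S) : u * v * u = u -> (u * v) * (u * v) = u * v.
  by move=> uvu; rewrite A uvu.
have yE : y = y * (x * z * (x * y)).
  by rewrite !A -(A y x z) -(A y _ x) xzx yxy.
have zE : z = z * x * (y * x) * z.
  by rewrite !A -(A z x y) -(A z _ x) xyx zxz.
rewrite [LHS]yE [RHS]zE (C _ _ (idl _ _ xzx) (idl _ _ xyx)).
rewrite (C _ _ (idl _ _ zxz) (idl _ _ yxy)) !A yxy.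
by rewrite -[RHS]A -[RHS]A -[RHS]A [z * (x * z)]A zxz A.
Qed.

Section NaturalOrder.
Variable S : inverseSemigroupType.
Implicit Types x y a b c d e : S.

Lemma natural_le_mulVK x y : natural_le x y -> y * x^-1 * x = x.
Proof.
by move=> /(congr1 (@sinv S)); rewrite !sinvM !sinvK => ->; rewrite smulVK.
Qed.

Lemma natural_le_idemr x e : e * e = e -> natural_le (x * e) x.
Proof. by move=> ee; apply/natural_leP; exists e. Qed.

(** The two bounds give [c * d = d] and [c^-1 * d = d^-1 * d]. Hence [d^-1 * d = c^-1 * c * d] lies
    below d, which forces d to equal the idempotent [d^-1 * d]. *)
Lemma natural_le_idem_sqr c d :
  natural_le d c -> natural_le d (c * c) -> d * d = d.
Proof.
move=> dc dcc.
have cd : c * d = d.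
  by rewrite -{1}(natural_le_mulVK dc) !smulA (natural_le_mulVK dcc).
have cVd : c^-1 * d = d^-1 * d.
  by have /(congr1 (@sinv S)) := natural_leV dc; rewrite !sinvM !sinvK.
have /natural_le_mulVK : natural_le (d^-1 * d) d.
  by apply/natural_leP'; exists (c^-1 * c); rewrite ?idem_Vmul // -smulA cd cVd.
rewrite (sinv_idem (idem_Vmul d)) -smulA idem_Vmul smulA smulVK => dE.
by have := idem_Vmul d; rewrite -dE.
Qed.

(** Inverting the second bound gives [e * e^-1] below [b * a^-1]; multiplying by e below a puts e
    below [b * a^-1 * a], hence below b. *)
Lemma natural_le_of_mulV a b e : natural_le e a ->
  natural_le (e * e^-1) (a * b^-1) -> natural_le e b.
Proof.
move=> ea /natural_leV; rewrite !sinvM !sinvK => eeba.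
have := natural_leM eeba ea; rewrite smulVK -smulA => eb.
exact: natural_le_trans eb (natural_le_idemr _ (idem_Vmul a)).
Qed.

End NaturalOrder.

Section DirectedSets.
Variable G : inverseSemigroupType.
Implicit Types A B C D E F : directed_set G.

Lemma directed_lb2 A x y : dset A x -> dset A y ->
  exists z, [/\ dset A z, natural_le z x & natural_le z y].
Proof. by case: (directedP A) => _; apply. Qed.

Lemma directed_lb3 A x y z : dset A x -> dset A y -> dset A z ->
  exists t, [/\ dset A t, natural_le t x, natural_le t y & natural_le t z].
Proof.
move=> Ax Ay Az; have [u [Au ux uy]] := directed_lb2 Ax Ay.
have [t [At tu tz]] := directed_lb2 Au Az.
by exists t; split=> //; apply: natural_le_trans tu _.
Qed.

Lemma set_prec_mul (A B C D : set G) :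
  set_prec A C -> set_prec B D -> set_prec (set_mul A B) (set_mul C D).
Proof.
move=> AC BD _ [c /AC[a Aa ac] [d /BD[b Bb bd] <-]].
by exists (a * b); [exists a => //; exists b | exact: natural_leM].
Qed.

Lemma set_prec_inv (A B : set G) :
  set_prec A B -> set_prec (set_inv A) (set_inv B).
Proof.
move=> AB _ [b /AB[a Aa ab] <-].
by exists a^-1; [exists a | exact: natural_leV].
Qed.

Lemma dclassP A B : dclass A = dclass B <-> set_sim A B.
Proof. by split=> [/eqmodP /asboolP //|AB]; apply/eqmodP; apply/asboolP. Qed.

Lemma dclass_ind (P : 'O(G) -> Prop) :
  (forall A, P (dclass A)) -> forall X, P X.
Proof. by move=> PA X; rewrite -[X]reprK; exact: PA. Qed.

(** The product is computed on [repr], which is only equivalent to the given sets; monotonicity of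
    [set_mul] absorbs the change of representatives. *)
Lemma dclassM A B : dclass A * dclass B = dclass (dmul A B).
Proof.
have /dclassP[AA' A'A] : dclass (repr (dclass A)) = dclass A by exact: reprK.
have /dclassP[BB' B'B] : dclass (repr (dclass B)) = dclass B by exact: reprK.
by apply/dclassP; split; apply: set_prec_mul.
Qed.

Lemma dclassV A : (dclass A)^-1 = dclass (dinv A).
Proof.
have /dclassP[AA' A'A] : dclass (repr (dclass A)) = dclass A by exact: reprK.
by apply/dclassP; split; apply: set_prec_inv.
Qed.

Lemma dclass_mulA : associative (@mul 'O(G)).
Proof.
elim/dclass_ind=> A; elim/dclass_ind=> B; elim/dclass_ind=> C.
(* Uninstantiated, dclassM would unify dclass ?A with an unfolded product. *)
rewrite (dclassM A B) (dclassM B C) !dclassM; apply/dclassP; split=> /= x.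
  case=> _ [a Aa [b Bb <-]] [c Cc <-]; exists (a * (b * c)).
    by exists a => //; exists (b * c) => //; exists b => //; exists c.
  by rewrite smulA.
case=> a Aa [_ [b Bb [c Cc <-]] <-]; exists (a * b * c).
  by exists (a * b); [exists a => //; exists b | exists c].
by rewrite smulA.
Qed.

Lemma dclass_mulVK A : dclass (dmul (dmul A (dinv A)) A) = dclass A.
Proof.
apply/dclassP; split=> /= x.
  move=> Ax; exists x => //.
  exists (x * x^-1); last by exists x => //; exact: smulVK.
  by exists x => //; exists x^-1 => //; exists x.
case=> _ [a Aa [_ [b Ab <-] <-]] [c Ac <-].
(* A common lower bound t satisfies [t = t * t^-1 * t], which lies below [a * b^-1 * c]. *)
have [t [At ta tb tc]] := directed_lb3 Aa Ab Ac.
exists t => //; rewrite -[t]smulVK.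
by apply: natural_leM => //; apply: natural_leM => //; exact: natural_leV.
Qed.

Lemma dinvK A : dclass (dinv (dinv A)) = dclass A.
Proof.
apply/dclassP; split=> /= x.
  by move=> Ax; exists x => //; exists x^-1; [exists x | exact: sinvK].
by case=> _ [a Aa <-] <-; exists a => //; rewrite sinvK.
Qed.

Lemma dclass_idem_cofinal E : dclass E * dclass E = dclass E ->
  forall c, dset E c -> exists d, [/\ dset E d, d * d = d & natural_le d c].
Proof.
rewrite dclassM => /dclassP[_ EEE] c Ec.
have [|a Ea acc] := EEE (c * c); first by exists c => //; exists c.
have [d [Ed da dc]] := directed_lb2 Ea Ec.
exists d; split=> //; apply: natural_le_idem_sqr dc _.
exact: natural_le_trans acc.
Qed.

(** Idempotents f' below f and e' below e commute, so [e' * f'] lies below [f * e]. Exchanging [E]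
    and [F] gives the reverse relation. *)
Lemma set_prec_idem_mul E F :
    dclass E * dclass E = dclass E -> dclass F * dclass F = dclass F ->
  set_prec (dmul E F) (dmul F E).
Proof.
move=> /dclass_idem_cofinal EE /dclass_idem_cofinal FF.
move=> _ [f /FF[f' [Ff' ff' f'f]] [e /EE[e' [Ee' ee' e'e]] <-]].
exists (e' * f'); first by exists e' => //; exists f'.
by rewrite (idemC ee' ff'); exact: natural_leM.
Qed.

Lemma dclass_idemC (X Y : 'O(G)) : X * X = X -> Y * Y = Y -> X * Y = Y * X.
Proof.
elim/dclass_ind: X => E; elim/dclass_ind: Y => F EE FF.
by rewrite !dclassM; apply/dclassP; split; apply: set_prec_idem_mul.
Qed.

Lemma dclass_inverse_semigroup : inverse_semigroup 'O(G).
Proof.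
apply: inverse_semigroup_idemC dclass_mulA _ dclass_idemC.
elim/dclass_ind=> A; split; rewrite dclassV.
  by rewrite (dclassM A) dclassM dclass_mulVK.
(* This is the first identity applied to [dinv A], whose inverse has the class of [A]. *)
by rewrite -[RHS]dclass_mulVK -2!dclassM dinvK.
Qed.

Lemma natural_le_dclass A B :
  natural_le (dclass A) (dclass B) <-> set_prec A B.
Proof.
rewrite /natural_le !dclassV !dclassM dclassP; split=> [[_ AAB] b Bb | AB].
  have [a Aa] := (directedP A).1.
  have [|_ [c Ac [_ [d Ad <-] <-]] cdab] := AAB (a * b^-1).
    by exists a => //; exists b^-1 => //; exists b.
  (* Being below c and d puts [e * e^-1] below [c * d^-1], hence below [a * b^-1]; being below a
     then yields e below b. *)
  have [e [Ae ec ed ea]] := directed_lb3 Ac Ad Aa.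
  exists e => //; apply: natural_le_of_mulV ea _.
  by apply: natural_le_trans cdab; apply: natural_leM => //; exact: natural_leV.
split; last exact: set_prec_mul (@set_prec_refl _ _) (set_prec_inv AB).
move=> _ [a Aa [_ [c Ac <-] <-]].
(* Any b serves: an e below a' is below b, and by definition of the order [e * b^-1] is then
   [e * e^-1]. *)
have [b Bb] := (directedP B).1; have [a' Aa' a'b] := AB b Bb.
have [e [Ae ea ec ea']] := directed_lb3 Aa Ac Aa'.
exists (e * b^-1); first by exists e => //; exists b^-1 => //; exists b.
rewrite (natural_le_trans ea' a'b : e * b^-1 = e * e^-1).
by apply: natural_leM => //; exact: natural_leV.
Qed.

End DirectedSets.

Theorem lemma3p2 (G : inverseSemigroupType) :
  (forall A B : directed_set G, dclass A * dclass B = dclass (dmul A B)) /\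
  (forall A : directed_set G, (dclass A)^-1 = dclass (dinv A)) /\
  inverse_semigroup 'O(G) /\
  (forall X Y : 'O(G),
     (natural_le X Y <->
        exists A B : directed_set G,
          [/\ dclass A = X, dclass B = Y & set_prec A B]) /\
     (natural_le X Y <->
        forall A B : directed_set G,
          dclass A = X -> dclass B = Y -> set_prec A B)).
Proof.
split; first exact: dclassM.
split; first exact: dclassV.
split; first exact: dclass_inverse_semigroup.
(* Both forms follow from [natural_le_dclass], which holds for arbitrary representatives. *)
move=> X Y; split; split.
- elim/dclass_ind: X => A; elim/dclass_ind: Y => B.
  by move/natural_le_dclass => AB; exists A, B.
- by case=> A [B [<- <- AB]]; apply/natural_le_dclass.
- by move=> XY A B AX BY; apply/natural_le_dclass; rewrite AX BY.
elim/dclass_ind: X => A; elim/dclass_ind: Y => B.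
by move=> AB; apply/natural_le_dclass/AB.
Qed.
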